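(* Let $A$ be a finite set with $|A|\ge 2$ and let $n\ge 2$. The maximum, over all permutations $f$ of $A^n$ (bijections $A^n\to A^n$), of the procedural complexity $\mathcal{L}(f)$ is exactly $2n-1$.
   Context: A transformation of $A^n$ is a map $f=(f_1,\dots,f_n):A^n\to A^n$; its coordinate function $f_i:A^n\to A$ is trivial if $f_i(x)=x_i$ for all $x$. An instruction is a transformation of $A^n$ with at most one nontrivial coordinate function. A program of length $L$ computing $f$ is a sequence of instructions $g^1,\dots,g^L$ with $f=g^L\circ\cdots\circ g^1$. The procedural complexity $\mathcal{L}(f)$ is the shortest length of a program computing $f$; the identity has procedural complexity $0$. *)

(* Defs.v *)
From mathcomp Require Import all_boot all_fingroup.

Set Implicit Arguments.
Unset Strict Implicit.
Unset Printing Implicit Defensive.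

Section Programs.
Variables (A : finType) (n : nat).

Definition state := {ffun 'I_n -> A}.
Definition transformation := state -> state.

Definition trivial_coord (f : transformation) (i : 'I_n) : bool :=
  [forall x : state, f x i == x i].

Definition instruction (g : transformation) : bool :=
  #|[set i | ~~ trivial_coord g i]| <= 1.

(* The list [:: g1; ...; gL] is in order of execution, so that
   compose [:: g1; ...; gL] is gL \o ... \o g1. *)
Definition compose (p : seq transformation) : transformation :=
  foldl (fun h g => g \o h) id p.

Definition program_for (f : transformation) (p : seq transformation) : Prop :=
  all instruction p /\ compose p =1 f.

Definition computable_in (f : transformation) (L : nat) : Prop :=
  exists2 p, program_for f p & size p = L.

(* The complexity of f is given by its graph: having_complexity f L means that
   f is computed by some program, and that the shortest length is L. *)
Definition having_complexity (f : transformation) (L : nat) : Prop :=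
  computable_in f L /\ forall L', computable_in f L' -> L <= L'.

Lemma having_complexity_inj f L1 L2 :
  having_complexity f L1 -> having_complexity f L2 -> L1 = L2.
Proof.
move=> [c1 min1] [c2 min2]; apply/eqP.
by rewrite eqn_leq min1 // min2.
Qed.

Lemma having_complexity_id : having_complexity id 0.
Proof. by split=> //; exists [::]. Qed.

End Programs.

(* Main.v *)
(** Upper bound: by induction on k, a permutation f of A^n fixing every
    coordinate of index > k has a program of length 2k+1.  Consider the
    bipartite multigraph whose edges are the states x, joining x with its k-th
    coordinate deleted to f(x) with its k-th coordinate deleted.  It is
    |A|-regular, hence by Hall's theorem it has a proper edge colouring c by A.
    Then f = g o h o g', where g' writes c(x) in coordinate k, h leaves
    coordinate k alone, and g writes the final value of coordinate k.

    Lower bound: let f be the transposition of two states a and b that differ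
    everywhere.  Each coordinate is updated by any program for f, so a program
    with at most 2n-2 instructions updates two coordinates i and j exactly
    once, say i first.  Between these two updates the state is h(x) with h
    injective, h(x)_i = f(x)_i and h(x)_j = x_j.  This is impossible, since
    more than |A|^(n-2) states x satisfy f(x)_i = a_i and x_j = b_j. *)

Require Import Defs.
From mathcomp Require Import all_boot all_fingroup.
From mathcomp Require Import zify.

Set Implicit Arguments.
Unset Strict Implicit.
Unset Printing Implicit Defensive.

(** * Edge colourings of regular bipartite multigraphs *)

Section Hall.
Variables V W : finType.
Implicit Types (N : V -> {set W}) (D S : {set V}).

Let nbh N S := \bigcup_(v in S) N v.

Let nbhU N S1 S2 : nbh N (S1 :|: S2) = nbh N S1 :|: nbh N S2.
Proof. exact: bigcup_setU. Qed.

Let nbhD N X S : nbh (fun v => N v :\: X) S = nbh N S :\: X.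
Proof.
apply/setP=> w; apply/bigcupP/setDP => [[v vS /setDP[wN wX]]|[/bigcupP[v vS wN] wX]].
  by split=> //; apply/bigcupP; exists v.
by exists v => //; apply/setDP.
Qed.

(* Halmos and Vaughan's induction; [m0] only provides values outside [D]. *)
Lemma hall (m0 : V -> W) N D :
    (forall S, S \subset D -> #|S| <= #|\bigcup_(v in S) N v|) ->
  exists2 m : V -> W,
    {in D, forall v, m v \in N v} & {in D &, injective m}.
Proof.
have [k] := ubnP #|D|; elim: k => // k IHk in N D *; rewrite ltnS => leDk hallD.
have [->|[v vD]] := set_0Vmem D.
  by exists m0 => [v|v w]; rewrite inE.
have [S /and3P[ltSD S0 /eqP eqS]|noS] :=
    pickP (fun S => [&& S \proper D, S != set0 & #|S| == #|nbh N S|]).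
(* A tight set [S] is matched first. The rest is matched outside [nbh N S]: Hall's condition for
   [S' :|: S], minus the equality for [S], gives it for [S']. *)
- have sSD := proper_sub ltSD.
  have [||m1 m1N m1I] := IHk N S.
  + exact: leq_trans (proper_card ltSD) leDk.
  + by move=> S' sS'S; apply: hallD (subset_trans sS'S sSD).
  have [||m2 m2N m2I] := IHk (fun v => N v :\: nbh N S) (D :\: S).
  + apply: leq_trans leDk; apply: proper_card.
    rewrite properEneq subsetDl andbT; apply/eqP => eqD.
    have /set0Pn[u uS] := S0; have := subsetP sSD u uS.
    by rewrite -eqD inE uS.
  + move=> S' /subsetDP[sS'D dS'S]; rewrite -/(nbh _ S') nbhD.
    have := hallD (S' :|: S); rewrite subUset sS'D sSD => /(_ isT).
    rewrite -/(nbh _ _) nbhU.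
    have := cardsUI S' S; rewrite (disjoint_setI0 dS'S) cards0.
    have := cardsID (nbh N S) (nbh N S').
    have := cardsUI (nbh N S') (nbh N S); lia.
  exists (fun u => if u \in S then m1 u else m2 u) => [u uD|u u' uD u'D].
    case: ifP => uS; first exact: m1N.
    by have /setDP[] : m2 u \in N u :\: nbh N S by apply: m2N; rewrite inE uS.
  have m12 x y : x \in S -> y \in D -> y \notin S -> m1 x != m2 y.
    move=> xS yD yS; apply/eqP => eqm.
    have /setDP[_ /negP[]] : m2 y \in N y :\: nbh N S.
      by apply: m2N; rewrite inE yS.
    by rewrite -eqm; apply/bigcupP; exists x => //; apply: m1N.
  case: ifPn => uS; case: ifPn => u'S eqm.
  + exact: m1I eqm.
  + by have := m12 _ _ uS u'D u'S; rewrite eqm eqxx.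
  + by have := m12 _ _ u'S uD uS; rewrite eqm eqxx.
  + by apply: m2I eqm; rewrite inE ?uS ?u'S.
(* Without a tight set, every nonempty proper subset of [D] has a spare neighbour, so [v] may take
   any neighbour [w]. *)
have [w wN] : exists w, w \in N v.
  have := hallD [set v]; rewrite sub1set vD cards1 big_set1 => /(_ isT).
  by case/card_gt0P=> w; exists w.
have [||m mN mI] := IHk (fun u => N u :\: [set w]) (D :\ v).
- by move: leDk; rewrite (cardsD1 v D) vD.
- move=> S /subsetD1P[sSD vS]; rewrite -/(nbh _ S) nbhD.
  have [->|S0] := eqVneq S set0; first by rewrite cards0.
  have := noS S; rewrite S0 /= properEneq sSD andbT.
  have -> /= : S != D by apply: contraNneq vS => ->.
  have := hallD S sSD; rewrite -/(nbh _ _).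
  have := cardsD1 w (nbh N S); case: (w \in _); lia.
exists (fun u => if u == v then w else m u) => [u uD|u u' uD u'D].
  case: eqP => [->//|/eqP uv].
  by have /setDP[] : m u \in N u :\: [set w] by apply: mN; rewrite !inE uv.
have mw x : x \in D -> x != v -> m x != w.
  move=> xD xv; have /setDP[_] : m x \in N x :\: [set w].
    by apply: mN; rewrite !inE xv.
  by rewrite inE.
case: eqVneq => [->|uv]; case: eqVneq => [->//|u'v] eqm.
- by have := mw _ u'D u'v; rewrite -eqm eqxx.
- by have := mw _ uD uv; rewrite eqm eqxx.
- by apply: mI eqm; rewrite !inE ?uv ?u'v.
Qed.

End Hall.

Section EdgeColouring.
Variables E V : finType.
Variables s t : E -> V.
Implicit Type F : {set E}.

Let deg (r : E -> V) F v := #|[set x in F | r x == v]|.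

Let sum_deg r F (S : {set V}) : \sum_(v in S) deg r F v = #|[set x in F | r x \in S]|.
Proof.
rewrite -sum1_card (partition_big r (mem S)) => [|x]; last first.
  by rewrite inE => /andP[].
apply: eq_bigr => v vS; rewrite /deg -sum1_card; apply: eq_bigl => x.
rewrite !inE; case: eqP => [->|]; last by rewrite !andbF.
by move: vS => /= ->; rewrite !andbT.
Qed.

(** Hall's condition follows by counting edges: those starting in [S] all end in its neighbourhood,
    and every vertex has the same degree on both sides. The map [e] picks one edge per vertex, since
    parallel edges are possible. *)
Lemma regular_matching q F :
    (forall v, deg s F v = q.+1) -> (forall v, deg t F v = q.+1) ->
  exists e : V -> E,
    [/\ forall v, e v \in F, cancel e s & injective (t \o e)].
Proof.
move=> degs degt.
have [|m mN mI] := @hall V V id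
    (fun v => t @: [set x in F | s x == v]) [set: V].
  move=> S _; set N := \bigcup_(v in S) _.
  rewrite -(leq_pmul2r (ltn0Sn q)) -!sum_nat_const.
  rewrite -(eq_bigr _ (fun v _ => degs v)) -(eq_bigr _ (fun v _ => degt v)).
  rewrite !sum_deg; apply/subset_leq_card/subsetP => x; rewrite !inE.
  case/andP=> xF xS; rewrite xF; apply/bigcupP; exists (s x) => //.
  by apply: imset_f; rewrite inE xF eqxx.
have eP v : exists x, [&& x \in F, s x == v & t x == m v].
  have /imsetP[x] := mN v (in_setT v).
  by rewrite inE => /andP[xF sx] ->; exists x; rewrite xF sx eqxx.
exists (fun v => xchoose (eP v)); split=> [v|v|v w].
- by case/and3P: (xchooseP (eP v)).
- by case/and3P: (xchooseP (eP v)) => _ /eqP.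
- rewrite /=; case/and3P: (xchooseP (eP v)) => _ _ /eqP->.
  by case/and3P: (xchooseP (eP w)) => _ _ /eqP->; apply: mI; rewrite ?inE.
Qed.

(** Removing a perfect matching leaves a regular multigraph of degree one less; the matching
    receives the new colour [q]. *)
Lemma regular_edge_colouring q F :
    (forall v, deg s F v = q) -> (forall v, deg t F v = q) ->
  exists2 c : E -> nat,
    {in F, forall x, c x < q} &
    {in F &, forall x y, c x = c y -> s x = s y \/ t x = t y -> x = y}.
Proof.
elim: q F => [|q IHq] F degs degt.
  have F0 x : x \notin F.
    by have /setP/(_ x) := cards0_eq (degs (s x)); rewrite !inE eqxx andbT => ->.
  by exists (fun _ => 0) => x; rewrite (negPf (F0 x)).
have [e [eF es et]] := regular_matching degs degt.
pose M := [set e v | v : V]; have sMF : M \subset F.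
  by apply/subsetP=> _ /imsetP[v _ ->].
have degD (r : E -> V) : bijective (r \o e) -> (forall v, deg r F v = q.+1) ->
    forall v, deg r (F :\: M) v = q.
  move=> [g geK gK] degr v; have := degr v; rewrite /deg.
  rewrite (cardsD1 (e (g v))) inE eF -[r _]/((r \o e) (g v)) gK eqxx => -[<-].
  congr #|pred_of_set _|; apply/setP=> x; rewrite !inE -andbA.
  have [rx|_] := eqVneq (r x) v; last by rewrite !andbF.
  rewrite !andbT; congr (~~ _ && _); apply/imsetP/eqP => [[u _ xE]|->];
    last by exists (g v).
  by rewrite xE -rx xE -[r _]/((r \o e) u) geK.
have [||c cq cI] := IHq (F :\: M).
- by apply: degD => //; exists id => v /=; rewrite es.
- by apply: degD => //; apply: injF_bij.
have MI x y : x \in M -> y \in M -> s x = s y \/ t x = t y -> x = y.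
  move=> /imsetP[v _ ->] /imsetP[w _ ->] [|/et->//].
  by rewrite !es => ->.
exists (fun x => if x \in M then q else c x) => [x xF|x y xF yF].
  case: ifPn => // xM; apply/ltnW/cq; exact/setDP.
have ltq z : z \in F -> z \notin M -> c z != q.
  by move=> zF zM; rewrite neq_ltn cq //; apply/setDP.
case: ifPn => xM; case: ifPn => yM eqc.
- exact: MI.
- by have := ltq _ yF yM; rewrite -eqc eqxx.
- by have := ltq _ xF xM; rewrite eqc eqxx.
- by apply: cI => //; apply/setDP.
Qed.

End EdgeColouring.

(** * Programs *)

Section Programs.
Variables (A : finType) (n : nat).
Local Notation state := (state A n).
Local Notation transformation := (transformation A n).
Implicit Types (f g h : transformation) (p : seq transformation) (x y : state).
Implicit Types (i j : 'I_n).

Lemma compose_cat p1 p2 : compose (p1 ++ p2) =1 compose p2 \o compose p1.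
Proof.
elim/last_ind: p2 => [|p2 g IHp] x; first by rewrite cats0.
by rewrite -rcons_cat /compose !foldl_rcons /=; congr g; apply: IHp.
Qed.

Lemma compose_cons g p : compose (g :: p) =1 compose p \o g.
Proof. by move=> x; rewrite -cat1s compose_cat. Qed.

(** Pointwise equality suffices, which avoids function extensionality when instructions are replaced
    by finite functions. *)
Lemma eq_compose (p1 p2 : seq transformation) :
  size p1 = size p2 -> (forall k, nth id p1 k =1 nth id p2 k) ->
  compose p1 =1 compose p2.
Proof.
elim: p1 p2 => [|g1 p1 IHp] [|g2 p2] //= [eqs] eqp x.
rewrite !compose_cons /=; have /= -> := eqp 0 x; apply: IHp => // k.
exact: eqp k.+1.
Qed.

Lemma instructionP i g :
  (forall x j, j != i -> g x j = x j) -> instruction g.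
Proof.
move=> gE; rewrite /instruction -(cards1 i).
apply/subset_leq_card/subsetP => j; rewrite !inE.
by apply: contraNT => ji; apply/forallP=> x; rewrite gE.
Qed.

Lemma eq_instruction f g : f =1 g -> instruction f = instruction g.
Proof.
move=> eqfg; rewrite /instruction; congr (#|pred_of_set _| <= 1).
by apply/setP=> i; rewrite !inE; congr (~~ _); apply: eq_forallb => x; rewrite eqfg.
Qed.

Definition fun_program (t : seq {ffun state -> state}) : seq transformation :=
  [seq (g : transformation) | g : {ffun state -> state} <- t].

(* Quantifying over finite functions makes computability decidable, so that a
   shortest program exists without classical logic. *)
Definition computable_inb f L : bool :=
  [exists t : L.-tuple {ffun state -> state},
     all (@instruction A n) (fun_program t)
     && [forall x, compose (fun_program t) x == f x]].

Lemma computable_inP f L : reflect (computable_in f L) (computable_inb f L).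
Proof.
apply: (iffP existsP) => [[t /andP[tI /forallP tf]]|[p [pI pf] sp]].
  exists (fun_program t).
    by split=> // x; apply/eqP.
  by rewrite size_map size_tuple.
have sP : size [seq finfun g | g : transformation <- p] == L.
  by rewrite size_map sp.
exists (Tuple sP); apply/andP; split; rewrite /fun_program /= -map_comp.
  rewrite all_map; apply: sub_all pI => g gI /=.
  by rewrite (eq_instruction (ffunE _)).
apply/forallP=> x; rewrite -(pf x); apply/eqP/eq_compose; first by rewrite size_map.
move=> k y; have [kp|pk] := ltnP k (size p).
  by rewrite (nth_map id) //= ffunE.
by rewrite !nth_default ?size_map.
Qed.

Lemma having_complexity_exists f L :
  computable_in f L -> exists2 L', having_complexity f L' & L' <= L.
Proof.
move=> /computable_inP fL; have exL : exists L', computable_inb f L' by exists L.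
have [L' /computable_inP fL' minL'] := ex_minnP exL.
by exists L'; [split=> // M /computable_inP|]; apply: minL'.
Qed.

(** * Upper bound *)

Definition update x i (a : A) : state := [ffun k => if k == i then a else x k].

Lemma update_eq x i a : update x i a i = a.
Proof. by rewrite ffunE eqxx. Qed.

Lemma update_neq x i a j : j != i -> update x i a j = x j.
Proof. by rewrite ffunE => /negPf->. Qed.

Definition delete_coord i x : {ffun {j | j != i} -> A} := [ffun k => x (val k)].

Lemma delete_coordP i x y :
  delete_coord i x = delete_coord i y <-> (forall j, j != i -> x j = y j).
Proof.
split=> [/ffunP exy j ji|exy]; last by apply/ffunP=> k; rewrite !ffunE exy ?(valP k).
by have := exy (Sub j ji); rewrite !ffunE.
Qed.

Lemma card_delete_coord_fibre i v : #|[set x | delete_coord i x == v]| = #|A|.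
Proof.
pose ext a : state := [ffun j => if insub j is Some k then v k else a].
have extI : injective ext.
  by move=> a b /ffunP/(_ i); rewrite !ffunE insubF ?eqxx.
rewrite -(card_imset A extI); apply: eq_card => x; rewrite inE.
apply/eqP/imsetP => [xv|[a _ ->]].
  exists (x i) => //; apply/ffunP=> j; rewrite ffunE.
  case: insubP => [k _ <-|]; first by rewrite -xv ffunE.
  by rewrite negbK => /eqP->.
by apply/ffunP=> k; rewrite !ffunE valK.
Qed.

Lemma coord_colouring i f : injective f ->
  exists c : state -> A,
    forall x y, c x = c y -> delete_coord i x = delete_coord i y \/
      delete_coord i (f x) = delete_coord i (f y) -> x = y.
Proof.
move=> fI.
have [||c cA cI] := @regular_edge_colouring _ _ (delete_coord i)
    (delete_coord i \o f) #|A| setT.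
- move=> v; rewrite -[RHS](card_delete_coord_fibre v).
  by apply: eq_card => x; rewrite !inE.
- move=> v; rewrite -[RHS](card_delete_coord_fibre v).
  rewrite -[RHS](card_preimset _ fI).
  by apply: eq_card => x; rewrite !inE.
exists (fun x => enum_val (Ordinal (cA x (in_setT x)))) => x y /enum_val_inj[].
by apply: cI; rewrite inE.
Qed.

(** The last clause drives the induction: [h] fixes coordinate [i] and every coordinate that [f]
    fixes. *)
Lemma coord_factorization i f : injective f ->
  exists g h g' : transformation,
    [/\ instruction g, instruction g', injective h, f =1 g \o h \o g' &
        forall x j, (j == i) || [forall y, f y j == y j] -> h x j = x j].
Proof.
move=> fI; have [c cI] := coord_colouring i fI.
(* Properness of [c] at the two ends of an edge makes [g'] and [F] injective; then [h] sends [g' x]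
   to [F x], and [g] sends [F x] to [f x]. *)
pose g' x := update x i (c x); pose F x := update (f x) i (c x).
have g'I : injective g'.
  move=> x y eqg; apply: cI.
    by rewrite -(update_eq x i (c x)) -/(g' x) eqg update_eq.
  left; apply/delete_coordP=> j ji.
  by rewrite -(update_neq x (c x) ji) -/(g' x) eqg update_neq.
have FI : injective F.
  move=> x y eqF; apply: cI.
    by rewrite -(update_eq (f x) i (c x)) -/(F x) eqF update_eq.
  right; apply/delete_coordP=> j ji.
  by rewrite -(update_neq (f x) (c x) ji) -/(F x) eqF update_neq.
exists (f \o invF FI), (F \o invF g'I), g'; split.
- apply: (@instructionP i) => x j ji /=.
  by rewrite -[in RHS](f_invF FI x) /F update_neq.
- by apply: (@instructionP i) => x j; apply: update_neq.
- exact: inj_comp FI (can_inj (f_invF g'I)).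
- by move=> x /=; rewrite !invF_f.
- move=> x j; rewrite -[in RHS](f_invF g'I x) /=; move: (invF g'I x) => y.
  rewrite /F /g'; have [->|ji /forallP/(_ y)/eqP fj] := eqVneq j i.
    by rewrite !update_eq.
  by rewrite !update_neq.
Qed.

Lemma computable_fixing_above k f : k < n -> injective f ->
  (forall x i, k < i -> f x i = x i) -> computable_in f (k.*2).+1.
Proof.
elim: k f => [|k IHk] f kn fI fE.
  exists [:: f] => //; split=> //=; rewrite andbT.
  by apply: (@instructionP (Ordinal kn)) => x j j0; apply: fE; rewrite lt0n.
have [g [h [g' [gI g'I hI fgh hE]]]] := coord_factorization (Ordinal kn) fI.
have [p [pI ph] sp] : computable_in h (k.*2).+1.
  apply: IHk (ltnW kn) hI _ => x i; rewrite leq_eqVlt => /predU1P[ki|ki].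
    by apply: hE; rewrite -val_eqE /= ki eqxx.
  by apply: hE; apply/orP; right; apply/forallP=> y; rewrite fE.
exists (g' :: rcons p g); last by rewrite /= size_rcons sp.
split=> [|x]; first by rewrite /= all_rcons g'I gI.
by rewrite compose_cons /= -cats1 compose_cat /= ph fgh.
Qed.

(** * Lower bound *)

Definition updates i g : bool := ~~ trivial_coord g i.

Lemma not_updates i g x : ~~ updates i g -> g x i = x i.
Proof. by rewrite negbK => /forallP/(_ x)/eqP. Qed.

Lemma compose_not_updates i p x : ~~ has (updates i) p -> compose p x i = x i.
Proof.
elim: p x => [|g p IHp] x //=; rewrite negb_or => /andP[gi pi].
by rewrite compose_cons /= IHp // (not_updates _ gi).
Qed.

Lemma instruction_updates i j g :
  instruction g -> updates i g -> updates j g -> i = j.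
Proof.
move=> /card_le1P gI gi gj; have := gI i; rewrite inE => /(_ gi j).
by rewrite !inE [~~ _]gj => /esym/eqP.
Qed.

(** Double counting: each instruction updates at most one coordinate. *)
Lemma sum_count_updates p :
  all (@instruction A n) p -> \sum_i count (updates i) p <= size p.
Proof.
elim: p => [_|g p IHp /andP[gI pI]]; first by rewrite big1.
rewrite /= big_split /= -add1n leq_add ?IHp //.
apply: leq_trans gI; rewrite -sum1_card [leqRHS]big_mkcond /=.
by apply: leq_sum => i _; rewrite inE /updates; case: trivial_coord.
Qed.

(** The program is cut at the only update of [i]. As [f] factors through the state at the cut, [h]
    is injective. *)
Lemma updated_once_intermediate i j f p :
    i != j -> injective f -> program_for f p ->
    count (updates i) p = 1 -> count (updates j) p = 1 ->
  exists2 h : transformation, injective h &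
    (forall x, h x i = f x i /\ h x j = x j) \/
    (forall x, h x i = x i /\ h x j = f x j).
Proof.
move=> ij fI [pI pf] ci cj; have : has (updates i) p by rewrite has_count ci.
move=> hi; case: (split_find hi) pI pf ci cj => g p1 p2 gi p1i.
rewrite all_cat all_rcons -andbA => /and3P[gI _ _] pf.
have gj : ~~ updates j g.
  by apply: contra ij => gj; apply/eqP/(instruction_updates gI).
rewrite !count_cat -cats1 !count_cat /= gi (negPf gj) !addn0.
move=> ci cj.
have p2i : ~~ has (updates i) p2 by rewrite has_count; lia.
have fE x : f x = compose p2 (g (compose p1 x)).
  by rewrite -pf -cats1 -catA cat1s compose_cat /= compose_cons.
(* If [j] is still to be updated, the cut comes just after [g]; otherwise just before it. *)
have [p1j|p1j] := boolP (has (updates j) p1); last first.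
  exists (fun x => g (compose p1 x)) => [x y exy|].
    by apply: fI; rewrite !fE exy.
  left=> x; rewrite fE (compose_not_updates _ p2i); split=> //.
  by rewrite (not_updates _ gj) compose_not_updates.
have p2j : ~~ has (updates j) p2.
  by move: p1j; rewrite !has_count; lia.
exists (compose p1) => [x y exy|]; first by apply: fI; rewrite !fE exy.
right=> x; rewrite compose_not_updates //; split=> //.
by rewrite fE (compose_not_updates _ p2j) (not_updates _ gj).
Qed.

Lemma tperm_no_intermediate (a b : state) i j (h : transformation) :
    i != j -> a i != b i -> a j != b j -> injective h ->
  ~ (forall x, h x i = tperm a b x i /\ h x j = x j).
Proof.
move=> ij abi abj hI hE.
(* The transposition fixes [T] pointwise and sends [b] to [a], so [h] maps [b |: T] into the smaller
   set [T]. *)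
pose T := [set y : state | (y i == a i) && (y j == b j)].
have [aT bT] : a \notin T /\ b \notin T.
  by rewrite !inE !eqxx (negPf abj) eq_sym (negPf abi).
have : #|b |: T| <= #|T|.
  rewrite -(card_imset (b |: T) hI).
  apply/subset_leq_card/subsetP => _ /imsetP[x xbT ->].
  rewrite inE; have [-> ->] := hE x.
  case/setU1P: xbT => [->|xT]; first by rewrite tpermR !eqxx.
  have xa : a != x by apply: contraNneq aT => ->.
  have xb : b != x by apply: contraNneq bT => ->.
  by rewrite tpermD //; move: xT; rewrite inE.
by rewrite cardsU1 bT ltnn.
Qed.

Lemma computable_tperm_length (a b : state) L :
  (forall i, a i != b i) -> computable_in (tperm a b) L -> 2 * n - 1 <= L.
Proof.
move=> ab [p [pI pf] <-]; rewrite leqNgt; apply/negP => ltp.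
have cnt i : 0 < count (updates i) p.
  rewrite -has_count; apply: contraT => /(compose_not_updates a).
  by rewrite pf tpermL => /esym/eqP; rewrite (negPf (ab i)).
pose U := [set i | count (updates i) p == 1].
have : 1 < #|U|.
  (* Coordinates outside [U] are updated at least twice, those in [U] once; with at most [2 * n - 2]
     updates in all, [U] has two elements. *)
  have : 2 * n <= \sum_i count (updates i) p + #|U|.
    rewrite -[#|U|]sum1_card [X in _ + X]big_mkcond -big_split /=.
    rewrite mulnC -[X in X * _]card_ord -sum_nat_const.
    apply: leq_sum => i _; rewrite inE; have := cnt i; case: eqP; lia.
  have := sum_count_updates pI; lia.
case/card_gt1P=> i [j [+ + ij]]; rewrite !inE => /eqP ci /eqP cj.
have [h hI hE] :=
  updated_once_intermediate ij (@perm_inj _ (tperm a b)) (conj pI pf) ci cj.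
case: hE => hE; first exact: tperm_no_intermediate ij (ab i) (ab j) hI hE.
(* When [j] is updated first, the roles of [i] and [j] are exchanged. *)
rewrite eq_sym in ij; apply: tperm_no_intermediate ij (ab j) (ab i) hI _ => x.
by have [] := hE x.
Qed.

End Programs.

Theorem theorem2 (A : finType) (n : nat) (hA : 2 <= #|A|) (hn : 2 <= n) :
  (forall f : {perm state A n},
     exists2 L : nat, having_complexity f L & L <= 2 * n - 1) /\
  (exists f : {perm state A n}, having_complexity f (2 * n - 1)).
Proof.
have upper (f : {perm state A n}) :
    exists2 L : nat, having_complexity f L & L <= 2 * n - 1.
  apply: having_complexity_exists.
  (* Coordinates are numbered from 0, so none lies above [n.-1] and every permutation qualifies. *)
  have -> : 2 * n - 1 = (n.-1.*2).+1 by lia.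
  apply: computable_fixing_above => [||x i ni]; first by lia.
    exact: perm_inj.
  by have := ltn_ord i; lia.
split=> //; have /card_gt1P[a [b [_ _ ab]]] := hA.
(* Two distinct constant states differ in every coordinate. *)
pose f : {perm state A n} := tperm [ffun=> a] [ffun=> b].
exists f; have [L fL leL] := upper f.
suff -> : 2 * n - 1 = L by [].
apply/eqP; rewrite eqn_leq leL andbT.
by apply: computable_tperm_length fL.1 => i; rewrite !ffunE.
Qed.
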